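(* Let $p$ be a prime, let $n\geq 1$, and let $A$ be an $\omega$-categorical associative nilalgebra over $\mathbb{F}_p$. If the adjoint group $A^\circ$ is $n$-Engel, then $A^\circ$ is nilpotent.
   Context: A structure $M$ is $\omega$-categorical if its first-order theory has a unique countable model up to isomorphism (finite structures are allowed); by the Ryll-Nardzewski theorem, for countable $M$ this is equivalent to: for every $n\in\mathbb{N}$ the componentwise action of $\mathrm{Aut}(M)$ on $M^n$ has only finitely many orbits, and the latter may be taken as the definition. Algebras are viewed as structures with $+$ and multiplication. Associative algebras are not assumed unital. A nilalgebra is an associative algebra in which for each element $x$ there is $k$ with $x^k=0$. The adjoint group $A^\circ$ of a nilalgebra $A$ is the set $A$ with the group operation $x\circ y=x+y+xy$ (identity $0$, inverse of $a$ equal to $\sum_{i\geq 1}(-a)^i$). A group is $n$-Engel if $[x,y,\ldots,y]=1$ ($y$ repeated $n$ times) for all $x,y$, where $[g,h]=g^{-1}h^{-1}gh$ and commutators are left-normed: $[x,y,z]=[[x,y],z]$. *)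

(* Defs.v *)
From HB Require Import structures.
From mathcomp Require Import all_boot all_order all_algebra.

Set Implicit Arguments.
Unset Strict Implicit.
Unset Printing Implicit Defensive.

Import GRing.Theory.
Local Open Scope ring_scope.

(* The algebras of ssralg are unital, so non-unital associative algebras over
   a field are introduced here. *)
HB.mixin Record Lmodule_isAssocAlgebra (K : fieldType) A
    of GRing.Lmodule K A := {
  amul : A -> A -> A;
  amulA : associative amul;
  amulDl : left_distributive amul +%R;
  amulDr : right_distributive amul +%R;
  amulZl : forall (k : K) x y, amul (k *: x) y = k *: amul x y;
  amulZr : forall (k : K) x y, amul x (k *: y) = k *: amul x y
}.

#[short(type="assocAlgType")]
HB.structure Definition AssocAlgebra (K : fieldType) :=
  {A of Lmodule_isAssocAlgebra K A & GRing.Lmodule K A}.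

Notation "x ** y" := (amul x y) (at level 40, left associativity) : ring_scope.

(* There is no unit, hence no zeroth power: [apowS x k] is x ^ (k + 1). *)
Definition apowS (K : fieldType) (A : assocAlgType K) (x : A) (k : nat) : A :=
  iter k (amul x) x.

HB.mixin Record AssocAlgebra_isNil (K : fieldType) A of AssocAlgebra K A := {
  nilP : forall x : A, exists k, apowS x k == 0
}.

#[short(type="nilAlgType")]
HB.structure Definition NilAlgebra (K : fieldType) :=
  {A of AssocAlgebra_isNil K A & AssocAlgebra K A}.

Definition adjoint (K : fieldType) (A : nilAlgType K) : Type := A.

Section AdjointGroup.
Variables (K : fieldType) (A : nilAlgType K).
Implicit Types x y z : A.

Definition circ x y : A := x + y + x ** y.

(* The sum of all powers (- x) ^ i, i >= 1, cut off at the first zero power. *)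
Definition circ_inv x : A :=
  \sum_(i < ex_minn (nilP (- x))) apowS (- x) i.

Lemma amul0l y : (0 : A) ** y = 0.
Proof. by apply: (addrI (0 ** y)); rewrite -amulDl !addr0. Qed.

Lemma amul0r x : x ** (0 : A) = 0.
Proof. by apply: (addrI (x ** 0)); rewrite -amulDr !addr0. Qed.

Lemma amulNl x y : (- x) ** y = - (x ** y).
Proof. by apply: (addrI (x ** y)); rewrite -amulDl !subrr amul0l. Qed.

Lemma amul_sumr x n (F : 'I_n -> A) :
  x ** (\sum_(i < n) F i) = \sum_(i < n) x ** F i.
Proof. by apply: big_morph => [y z|]; rewrite ?amulDr ?amul0r. Qed.

Lemma circA : associative circ.
Proof.
move=> x y z; rewrite /circ !amulDl !amulDr amulA !addrA.
by rewrite [LHS](ACl (1*2*5*3*6*4*7)).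
Qed.

Lemma circ0l : left_id 0 circ.
Proof. by move=> x; rewrite /circ add0r amul0l addr0. Qed.

Lemma circ0r : right_id 0 circ.
Proof. by move=> x; rewrite /circ addr0 amul0r addr0. Qed.

Lemma circV : right_inverse 0 circ_inv circ.
Proof.
move=> x; rewrite /circ /circ_inv; case: ex_minnP => m /eqP xm0 _.
have -> : x ** (\sum_(i < m) apowS (- x) i)
    = - (\sum_(i < m) apowS (- x) i.+1).
  by rewrite amul_sumr -sumrN; apply: eq_bigr => i _; rewrite /= amulNl opprK.
have : \sum_(i < m.+1) apowS (- x) i = \sum_(i < m) apowS (- x) i.
  by rewrite big_ord_recr /= xm0 addr0.
rewrite big_ord_recl /= => <-.
by rewrite addrA subrr add0r subrr.
Qed.

Lemma circVl : left_inverse 0 circ_inv circ.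
Proof.
move=> x; have e := circV (circ_inv x).
suff xE : x = circ_inv (circ_inv x) by rewrite {2}xE.
by rewrite -[LHS]circ0r -{1}e circA circV circ0l.
Qed.

HB.instance Definition _ := Choice.on (adjoint A).
HB.instance Definition _ :=
  isGroup.Build (adjoint A) circA circ0l circ0r circVl circV.

Lemma adjoint_mulE (x y : adjoint A) : (x * y)%g = x + y + x ** y :> A.
Proof. by []. Qed.

Lemma adjoint_oneE : 1%g = 0 :> adjoint A.
Proof. by []. Qed.

End AdjointGroup.

(* Automorphisms of A as a structure with addition and multiplication only;
   over a prime field they are automatically linear. *)
Definition is_automorphism (K : fieldType) (A : assocAlgType K) (f : A -> A) :=
  [/\ bijective f, {morph f : x y / x + y} & {morph f : x y / x ** y}].

(* The orbit condition of the Ryll-Nardzewski theorem, [s] listing orbit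
   representatives. It implies omega-categoricity in any cardinality and is
   equivalent to it for countable A, so countability is not required. *)
Definition omega_categorical (K : fieldType) (A : assocAlgType K) :=
  forall n : nat, exists s : seq (n.-tuple A), forall u : n.-tuple A,
    exists2 v, v \in s & exists2 f, is_automorphism f & u = map_tuple f v.

Section GroupProperties.
Variable G : groupType.
Local Open Scope group_scope.

Definition engel (n : nat) :=
  forall x y : G, iter n (fun g => [~ g, y]) x = 1.

Inductive generated (S : G -> Prop) : G -> Prop :=
| Generated_mem x : S x -> generated S x
| Generated_one : generated S 1
| Generated_mul x y : generated S x -> generated S y -> generated S (x * y)
| Generated_inv x : generated S x -> generated S x^-1.

Fixpoint lower_central (k : nat) : G -> Prop :=
  if k is k'.+1 then
    generated (fun z => exists x y, lower_central k' x /\ z = [~ x, y])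
  else fun=> True.

Definition nilpotent_group :=
  exists c : nat, forall x : G, lower_central c x -> x = 1.

End GroupProperties.

(* Main.v *)
Require Import Defs.
From HB Require Import structures.
From mathcomp Require Import all_boot all_order all_algebra.
From mathcomp Require Import boolp.

(* A itself is nilpotent. Modulo a maximal invariant ideal I with A / I not
   nilpotent, invariant sets behave like ideals of a prime ring (prime_modulo).
   Levitzki's argument gives e outside I with eAe in I; on the additive span N of
   these e, products containing n + 1 factors u lie in I, with n the same for all
   u in N and minimal. Expanding such products for sums of elements of N gives,
   modulo I and for all contexts p, q made of n factors,
     p(u) y q(v) = (-1)^n p(v) y q(u),   p(u) y q(u) = 0,
   so products of such factors behave as if they commuted. Hence for every m there
   are y_i, c_i, d_i, x_i (i <= m) with y_i c_j = delta_ij t, d_i x_j = delta_ij t'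
   and t t' outside I. For b = sum c_i d_(i+1) and g = sum c_(i+1) d_(i+1), the chain
   W_0 = I, W_(k+1) = {y | y g in W_k b + I} increases strictly for m steps, as y_k
   is in W_(k+1) but not in W_k. So the triples (b, g, y_k) lie in different orbits,
   and m is bounded by the number of orbits on A^3. *)

Set Implicit Arguments.
Unset Strict Implicit.
Unset Printing Implicit Defensive.

Import GRing.Theory.
Local Open Scope ring_scope.

(** * Ideals, additive spans and powers of a non-unital algebra *)

Section AssocAlgebra.
Variables (K : fieldType) (A : assocAlgType K).
Implicit Types (x y z a b u w : A) (xs ys : seq A) (I Z C S P Q : A -> Prop).

Lemma amul0x y : (0 : A) ** y = 0.
Proof. by rewrite -(scale0r (0 : A)) amulZl !scale0r. Qed.

Lemma amulx0 x : x ** (0 : A) = 0.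
Proof. by rewrite -(scale0r (0 : A)) amulZr !scale0r. Qed.

Lemma amulNx x y : (- x) ** y = - (x ** y).
Proof. by rewrite -scaleN1r amulZl scaleN1r. Qed.

Lemma amulxN x y : x ** (- y) = - (x ** y).
Proof. by rewrite -scaleN1r amulZr scaleN1r. Qed.

Lemma amulBl x y z : (x - y) ** z = x ** z - y ** z.
Proof. by rewrite amulDl amulNx. Qed.

Lemma amulBr x y z : z ** (x - y) = z ** x - z ** y.
Proof. by rewrite amulDr amulxN. Qed.

Lemma amul_suml y n (F : 'I_n -> A) :
  (\sum_(i < n) F i) ** y = \sum_(i < n) F i ** y.
Proof. by apply: (big_morph (fun x => x ** y)) => [z t|]; rewrite ?amulDl ?amul0x. Qed.

Lemma amul_sumrx x n (F : 'I_n -> A) :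
  x ** (\sum_(i < n) F i) = \sum_(i < n) x ** F i.
Proof. by apply: big_morph => [y z|]; rewrite ?amulDr ?amulx0. Qed.

Definition subgroup Z := Z 0 /\ forall x y, Z x -> Z y -> Z (x - y).

Definition right_closed Z := forall x a, Z x -> Z (x ** a).

Definition ideal I :=
  [/\ subgroup I, right_closed I & forall a x, I x -> I (a ** x)].

Section Subgroup.
Variable Z : A -> Prop.
Hypothesis subgroupZ : subgroup Z.

Lemma subgroup0 : Z 0.
Proof. by case: subgroupZ. Qed.

Lemma subgroupB x y : Z x -> Z y -> Z (x - y).
Proof. by case: subgroupZ => _; apply. Qed.

Lemma subgroupN x : Z x -> Z (- x).
Proof. by move=> Zx; rewrite -sub0r; apply: subgroupB => //; exact: subgroup0. Qed.

Lemma subgroupD x y : Z x -> Z y -> Z (x + y).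
Proof. by move=> Zx Zy; rewrite -[y]opprK; apply/subgroupB/subgroupN. Qed.

Lemma subgroup_sum n (F : 'I_n -> A) :
  (forall i, Z (F i)) -> Z (\sum_(i < n) F i).
Proof. by move=> ZF; apply: big_ind => //; [exact: subgroup0 | exact: subgroupD]. Qed.

Lemma subgroup_sign k x : Z x -> Z ((-1) ^+ k *: x).
Proof.
by move=> Zx; rewrite -signr_odd scaler_sign; case: (odd k) => //; exact: subgroupN.
Qed.

Lemma subgroup_refl x : Z (x - x).
Proof. by rewrite subrr; exact: subgroup0. Qed.

Lemma subgroup_sym x y : Z (x - y) -> Z (y - x).
Proof. by move=> /subgroupN; rewrite opprB. Qed.

Lemma subgroup_trans y x z : Z (x - y) -> Z (y - z) -> Z (x - z).
Proof. by move=> Zxy Zyz; rewrite -(subrKA y); exact: subgroupD. Qed.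

Lemma subgroup_congr x y : Z (x - y) -> Z y -> Z x.
Proof. by move=> Zxy Zy; rewrite -(subrK y x); exact: subgroupD. Qed.

End Subgroup.

Lemma ideal_subgroup I : ideal I -> subgroup I. Proof. by case. Qed.

Lemma idealMr I x a : ideal I -> I x -> I (x ** a).
Proof. by case=> _ + _; apply. Qed.

Lemma idealMl I a x : ideal I -> I x -> I (a ** x).
Proof. by case=> _ _; apply. Qed.

Inductive span S : A -> Prop :=
| span_zero : span S 0
| span_add x y : S x -> span S y -> span S (x + y).

Lemma span_mem S x : S x -> span S x.
Proof. by move=> Sx; rewrite -[x]addr0; apply: span_add => //; exact: span_zero. Qed.

Lemma spanD S x y : span S x -> span S y -> span S (x + y).
Proof.
elim=> [|a b Sa _ IH] Sy; first by rewrite add0r.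
by rewrite -addrA; apply: span_add => //; exact: IH.
Qed.

Lemma span_subgroup S : (forall x, S x -> S (- x)) -> subgroup (span S).
Proof.
move=> SN; split; first exact: span_zero.
move=> x y Sx Sy; apply: spanD => //.
elim: Sy => [|a b Sa _ IH]; first by rewrite oppr0; exact: span_zero.
by rewrite opprD; apply: span_add => //; exact: SN.
Qed.

Lemma span_sub S Z : subgroup Z -> (forall x, S x -> Z x) ->
  forall x, span S x -> Z x.
Proof.
move=> sgZ SZ x; elim=> [|a b Sa _ IH]; first exact: subgroup0.
by apply: subgroupD => //; exact: SZ.
Qed.

(* The additive span of the products of k + 1 elements. *)
Fixpoint apow k : A -> Prop :=
  if k is k'.+1 then span (fun z => exists a b, apow k' a /\ z = a ** b)
  else fun=> True.

Lemma apow_subgroup k : subgroup (apow k).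
Proof.
elim: k => [|k IH]; first by split.
apply: span_subgroup => _ [a [b [ka ->]]]; exists (- a), b.
by split; [exact: subgroupN ka | rewrite amulNx].
Qed.

Lemma apowMr k x a : apow k x -> apow k.+1 (x ** a).
Proof. by move=> kx; apply: span_mem; exists x, a. Qed.

Lemma apowMl k x a : apow k x -> apow k.+1 (a ** x).
Proof.
elim: k x => [|k IH] x; first by move=> _; apply: span_mem; exists a, x.
apply: (span_sub (Z := fun x => apow k.+2 (a ** x))) => [|_ [b [c [kb ->]]]].
  split=> [|y z]; first by rewrite amulx0; exact: subgroup0 (apow_subgroup _).
  by rewrite amulBr; apply: subgroupB; exact: apow_subgroup.
by rewrite amulA; apply: apowMr; exact: IH.
Qed.

Lemma apow_ideal k : ideal (apow k).
Proof.
elim: k => [|k [_ IHr IHl]]; first by split.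
have sk := apow_subgroup k.+1.
split=> // [x a | a x].
  apply: (span_sub (Z := fun x => apow k.+1 (x ** a))) => [|_ [b [c [kb ->]]]].
    split=> [|y z]; first by rewrite amul0x; exact: subgroup0.
    by rewrite amulBl; exact: subgroupB.
  by apply: apowMr; exact: IHr.
apply: (span_sub (Z := fun x => apow k.+1 (a ** x))) => [|_ [b [c [kb ->]]]].
  split=> [|y z]; first by rewrite amulx0; exact: subgroup0.
  by rewrite amulBr; exact: subgroupB.
by rewrite amulA; apply: apowMr; exact: IHl.
Qed.

(** By associativity the [i + j + 2] factors break into blocks of [i + 1] and [j + 1]. *)
Lemma apow_split i j x : apow (i + j).+1 x ->
  span (fun z => exists a b, [/\ apow i a, apow j b & z = a ** b]) x.
Proof.
set T := fun j z => exists a b, [/\ apow i a, apow j b & z = a ** b].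
have TN k : subgroup (span (T k)).
  apply: span_subgroup => _ [a [b [ia kb ->]]]; exists a, (- b).
  by split; rewrite ?amulxN //; apply: subgroupN kb; exact: apow_subgroup.
elim: j x => [|j IH] x.
  rewrite addn0; apply: span_sub; first exact: TN.
  by move=> _ [a [b [ia ->]]]; apply: span_mem; exists a, b.
rewrite addnS; apply: span_sub => [|_ [a [b [/IH ija ->]]]]; first exact: TN.
elim: ija => [|c d [e [f [ie jf ->]]] _ IHd].
  by rewrite amul0x; exact: span_zero.
rewrite amulDl; apply: spanD => //; apply: span_mem.
by exists e, (f ** b); rewrite amulA; split=> //; exact: apowMr.
Qed.

End AssocAlgebra.

(** * Words in one repeated letter, modulo an ideal *)

Section Words.
Variables (K : fieldType) (A : assocAlgType K).
Implicit Types (x y z a b u w : A) (xs ys : seq A) (I Z C S P Q : A -> Prop).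

(** The product a x_1 u x_2 u ... x_k u. The leading [a] gives the empty word a value although there
    is no unit. *)
Definition word u a xs : A := foldl (fun t x => t ** x ** u) a xs.

Lemma word_cat u a xs ys : word u a (xs ++ ys) = word u (word u a xs) ys.
Proof. exact: foldl_cat. Qed.

Lemma amul_word b u a xs : b ** word u a xs = word u (b ** a) xs.
Proof. by elim: xs a => //= x xs IH a; rewrite IH !amulA. Qed.

Lemma wordB u a b xs : word u (a - b) xs = word u a xs - word u b xs.
Proof. by elim: xs a b => //= x xs IH a b; rewrite !amulBl IH. Qed.

Lemma word0 u xs : word u 0 xs = 0.
Proof. by have := wordB u 0 0 xs; rewrite !subrr. Qed.

Lemma wordN u a xs : word u (- a) xs = - word u a xs.
Proof. by have := wordB u 0 a xs; rewrite word0 !sub0r. Qed.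

Lemma word_opp u a xs : word (- u) a xs = (-1) ^+ size xs *: word u a xs.
Proof.
elim: xs a => /= [|x xs IH] a; first by rewrite expr0 scale1r.
by rewrite IH amulxN wordN scalerN exprS mulN1r scaleNr.
Qed.

Lemma word_closed Z u a xs : right_closed Z -> Z a -> Z (word u a xs).
Proof.
by move=> rZ; elim: xs a => //= x xs IH a Za; apply: IH; exact/rZ/rZ.
Qed.

(** When [u + e] is replaced by [u] letter by letter, each discarded term has the form [c ** x ** e]
    with a prefix [c] in [C]; it falls into [Z] and stays there under right multiplication. *)
Lemma word_perturb Z C u e a b xs :
  subgroup Z -> right_closed Z -> right_closed C ->
  (forall c x, C c -> Z (c ** x ** e)) ->
  C a -> Z (a - b) -> Z (word (u + e) a xs - word u b xs).
Proof.
move=> sZ rZ rC CZ; elim: xs a b => //= x xs IH a b Ca Zab.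
apply: IH; first exact/rC/rC.
rewrite amulDr addrAC -amulBl -amulBl; apply: subgroupD => //; last exact: CZ.
exact/rZ/rZ.
Qed.

Section Modulo.
Variable I : A -> Prop.
Hypothesis idealI : ideal I.
Let sI := ideal_subgroup idealI.

Lemma right_closed_ideal : right_closed I.
Proof. by case: idealI. Qed.

Definition vanishing N n := forall u a xs, N u -> size xs = n -> I (word u a xs).

Lemma vanishing_leq N n u a xs :
  vanishing N n -> N u -> (n <= size xs)%N -> I (word u a xs).
Proof.
move=> vN Nu le_n_xs; rewrite -(cat_take_drop n xs) word_cat.
apply: word_closed right_closed_ideal _; apply: vN => //.
by rewrite size_take_min; apply/minn_idPl.
Qed.

Section Swap.
Variables (N : A -> Prop) (n : nat).
Hypotheses (sN : subgroup N) (n_gt0 : (0 < n)%N) (vN : vanishing N n.+1).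

(** Merging [y], [b] and the first entry of [ys] into one entry gives a single word with [2 n]
    letters [u], and [2 n >= n + 1]. *)
Lemma word_nil u y a xs b ys : N u -> size xs = n -> size ys = n ->
  I (word u a xs ** y ** word u b ys).
Proof.
move=> Nu sxs; case: ys => [|z ys] szys; first by move: n_gt0; rewrite -szys.
rewrite amul_word.
have -> : word u (word u a xs ** y ** b) (z :: ys)
    = word u a (xs ++ (y ** b ** z) :: ys) by rewrite word_cat /= !amulA.
apply: vanishing_leq vN Nu _.
by rewrite size_cat sxs -addn1 leq_add2l.
Qed.

(* Expand the left word: a mixed term has at least n + 1 letters w in all. *)
Lemma word_subl u w y a xs b ys : N w -> size xs = n -> size ys = n ->
  I (word (w - u) a xs ** y ** word w b ys
     - (-1) ^+ n *: (word u a xs ** y ** word w b ys)).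
Proof.
move=> Nw sxs sys.
pose Z t := forall zs, size zs = n -> I (word w t zs).
have sZ : subgroup Z.
  split=> [zs _|s t Zs Zt zs szs]; first by rewrite word0; exact: subgroup0.
  by rewrite wordB; apply: subgroupB => //; [exact: Zs | exact: Zt].
(* As [n > 0] there is a first entry [z], which absorbs the extra factor [t]. *)
have rZ : right_closed Z.
  move=> s t Zs [|z zs] szs; first by move: n_gt0; rewrite -szs.
  have -> : word w (s ** t) (z :: zs) = word w s ((t ** z) :: zs).
    by rewrite /= !amulA.
  exact: Zs.
have := @word_perturb Z (fun=> True) (- u) w a a xs sZ rZ
  (fun _ _ _ => Logic.I).
rewrite (addrC (- u) w) word_opp sxs => Zd; rewrite -!amulZl -!amulBl amul_word.
apply: (rZ _ _ (rZ _ _ (Zd _ _ _))) => //; last exact: subgroup_refl.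
move=> c x _ zs szs.
by have := vN (u := w) c (xs := x :: zs) Nw; rewrite /= szs; exact.
Qed.

(** The left word already carries [n] letters [w], so one more [w] on the right puts a term in [I].
    Only the term without it survives, and its letters [- u] produce the sign. *)
Lemma word_subr u w y a xs b ys : N w -> size xs = n -> size ys = n ->
  I (word w a xs ** y ** word (w - u) b ys
     - (-1) ^+ n *: (word w a xs ** y ** word u b ys)).
Proof.
move=> Nw sxs sys.
pose C t := forall x, I (t ** x ** w).
have rC : right_closed C by move=> s t Cs x; rewrite -(amulA s); exact: Cs.
have := @word_perturb I C (- u) w (word w a xs ** y ** b)
  (word w a xs ** y ** b) ys sI right_closed_ideal rC (fun c x Cc => Cc x).
rewrite (addrC (- u) w) word_opp sys !amul_word; apply; last exact: subgroup_refl.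
apply/rC/rC => x.
have -> : word w a xs ** x ** w = word w a (xs ++ [:: x]) by rewrite word_cat.
by apply: vN => //; rewrite size_cat sxs addn1.
Qed.

(** With [d = v - u] and the contexts left out, modulo [I]: (-1)^n u v = d v by [word_subl]; d v = d
    u by [word_subr] applied to v = d - (- u), where two signs cancel; d u = v u by [word_subl]
    applied to u - v = - d. *)
Lemma word_swap u v y a xs b ys : N u -> N v -> size xs = n -> size ys = n ->
  I (word u a xs ** y ** word v b ys
     - (-1) ^+ n *: (word v a xs ** y ** word u b ys)).
Proof.
move=> Nu Nv sxs sys.
have Nvu : N (v - u) by exact: subgroupB.
have signI s t : I ((-1) ^+ n *: s - t) -> I (s - (-1) ^+ n *: t).
  by move/(subgroup_sign sI n); rewrite scalerBr signrZK.
have h1 := word_subl u y a b Nv sxs sys.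
have h2 := word_subr (- u) y a b Nvu sxs sys.
rewrite opprK subrK word_opp sys amulZr signrZK in h2.
have h3 := word_subl v y a b Nu sxs sys.
rewrite -(opprB v u) word_opp sxs !amulZl -scalerBr in h3.
move/(subgroup_sign sI n): h3; rewrite signrZK => h3.
apply: signI; apply: subgroup_trans (subgroup_sym sI h1) _ => //.
exact: subgroup_trans h2 h3.
Qed.

End Swap.

(* Levitzki: an element a with (a z)^n a = 0 for all z and n >= 2 minimal would
   give b = (a z)^(n-1) a <> 0 with (b w)^(n-1) b = 0 for all w. *)
Lemma levitzki n a : ~ I a ->
  (forall z, I (iter n.+1 (amul (a ** z)) a)) ->
  exists2 e, ~ I e & forall z, I (e ** z ** e).
Proof.
elim: n a => [|n IH] a nIa ha; first by exists a.
case: (pselect (forall z, I (iter n.+1 (amul (a ** z)) a))) => [|/existsNP[z]].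
  exact: IH.
set x := a ** z; set b := iter n.+1 _ a => nIb.
apply: (IH b) => // w; set c := b ** w.
have iterM t k s r : iter k (amul t) (s ** r) = iter k (amul t) s ** r.
  by elim: k => //= k ->; rewrite amulA.
have iterI t k s : I s -> I (iter k (amul t) s).
  by move=> Is; elim: k => //= k; exact: idealMl.
have xc : I (x ** c) by rewrite amulA; apply: idealMr => //; exact: ha.
have [r cE] : exists r, c = a ** r.
  by exists (z ** iter n (amul x) a ** w); rewrite !amulA.
(* Since [x + c = a ** (z + r)], [E n.+2] lies in [I]. Expanding it with [x ** c] in [I] leaves c b
   + c^2 E_n, which is the relation [h]. *)
pose E k := iter k (amul (x + c)) a.
have ES k : E k.+1 = x ** E k + c ** E k by rewrite -amulDl.
have xE k : I (x ** E k - iter k.+1 (amul x) a).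
  elim: k => [|k IHk]; first exact: subgroup_refl.
  rewrite ES amulDr addrAC -amulBr.
  apply: subgroupD => //; first exact: idealMl.
  by rewrite amulA; exact: idealMr.
have EP : I (E n.+2).
  have xcE : x + c = a ** (z + r) by rewrite amulDr cE.
  by rewrite /E xcE; exact: ha.
have h : I (c ** b + c ** (c ** E n)).
  rewrite -amulDr; have : I (c ** (E n.+1 - (b + c ** E n))).
    apply: idealMl => //; rewrite ES opprD addrACA subrr addr0.
    exact: xE.
  rewrite amulBr => /(subgroup_sym sI) hc; apply: subgroup_congr hc _ => //.
  have -> : c ** E n.+1 = E n.+2 - x ** E n.+1 by rewrite (ES n.+1) addrAC subrr add0r.
  apply: subgroupB => //; apply: subgroup_congr (xE _) _ => //; exact: ha.
(* After multiplication of [h] by c^n, the second term is c^(n+2) times an element that is [a] or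
   starts with [a]; as c = a r, it is covered by [ha]. *)
have hn : I (iter n (amul c) (c ** (c ** E n))).
  have -> : iter n (amul c) (c ** (c ** E n)) = iter n.+2 (amul c) (E n).
    by rewrite !iterSr.
  suff [E0|[s ->]] : E n = a \/ exists s, E n = a ** s.
  - by rewrite E0 cE; exact: ha.
  - by rewrite iterM cE; apply: idealMr => //; exact: ha.
  rewrite /E; case: (n) => [|m]; [by left | right].
  by eexists; rewrite /= /x cE -amulDr -amulA.
have -> : iter n.+1 (amul c) b = iter n (amul c) (c ** b) by rewrite iterSr.
have iterD t k s q : iter k (amul t) (s + q) = iter k (amul t) s + iter k (amul t) q.
  by elim: k => //= k ->; rewrite amulDr.
rewrite -[X in I X](addrK (iter n (amul c) (c ** (c ** E n)))) -iterD.
by apply: subgroupB => //; exact: iterI.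
Qed.

Definition trivial_sandwich e := forall z, I (e ** z ** e).

(** Two letters [e] put a term in [I], so at most one [e] matters. Among [k + k] letters this leaves
    [k] consecutive letters [u] before or after it. *)
Lemma sandwich_word k u e :
  (forall a xs, size xs = k -> I (word u a xs)) -> trivial_sandwich e ->
  forall a xs, size xs = (k + k)%N -> I (word (u + e) a xs).
Proof.
move=> uk eI.
suff main j a xs : (forall ys, size ys = j -> I (word u a ys)) ->
    size xs = (j + k)%N -> I (word (u + e) a xs).
  by move=> a xs; apply: main => ys; exact: uk.
elim: j a xs => [|j IH] a xs ha.
  by move=> _; apply: word_closed right_closed_ideal _; exact: (ha [::]).
case: xs => //= x xs [sxs].
have -> : a ** x ** (u + e) = a ** x ** u - a ** x ** (- e).
  by rewrite amulDr amulxN opprK.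
rewrite wordB; apply: subgroupB => //.
  by apply: IH => // ys sys; apply: (ha (x :: ys)); rewrite /= sys.
pose C t := forall y, I (t ** y ** e).
have rC : right_closed C by move=> s t Cs y; rewrite -(amulA s); exact: Cs.
have Cx : C (a ** x ** - e).
  move=> y; rewrite amulxN !amulNx -!amulA; apply: subgroupN => //.
  by do 2!apply: idealMl => //; rewrite amulA.
have := word_perturb u xs sI right_closed_ideal rC (fun c y Cc => Cc y) Cx
  (subgroup_refl sI _).
move=> h; apply: subgroup_congr h _ => //.
rewrite -(cat_take_drop k xs) word_cat.
apply: word_closed right_closed_ideal _; apply: uk.
by rewrite size_take_min; apply/minn_idPl; rewrite sxs leq_addl.
Qed.

End Modulo.
End Words.

(** * Existence of arbitrarily long dual systems modulo an ideal *)

Section DualSystems.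
Variables (K : fieldType) (A : assocAlgType K) (I : A -> Prop).
Hypothesis idealI : ideal I.
Let sI := ideal_subgroup idealI.

Definition dual_system m (y c : nat -> A) (t : A) :=
  (forall i, (i <= m)%N -> I (y i ** c i - t)) /\
  (forall i j, (i <= m)%N -> (j <= m)%N -> i != j -> I (y i ** c j)).

Section Existence.
Variables (slot : (A -> A) -> Prop) (N : A -> Prop) (k : nat).
Hypothesis slot_nil : forall s t u y, slot s -> slot t -> N u ->
  I (s u ** y ** t u).
Hypothesis slot_swap : forall s t u v y, slot s -> slot t -> N u -> N v ->
  I (s u ** y ** t v - (-1) ^+ k *: (s v ** y ** t u)).

Variables (x0 : A) (a : nat -> A) (s : nat -> A -> A).
Hypothesis slot_s : forall i, slot (s i).

(** The word x0 a_0 s_0(v_0) a_1 s_1(v_1) ... with [m] slots. A slot stands for a map sending [u] to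
    [word u b xs], kept abstract so that the construction also runs in the opposite algebra. *)
Fixpoint slot_word (v : nat -> A) m : A :=
  if m is i.+1 then slot_word v i ** a i ** s i (v i) else x0.

Definition replace (v : nat -> A) j x i := if i == j then x else v i.

Lemma eq_slot_word v v' m : (forall i, (i < m)%N -> v i = v' i) ->
  slot_word v m = slot_word v' m.
Proof.
elim: m => //= m IH h; rewrite (h m) // IH // => i im.
by apply: h; rewrite ltnS ltnW.
Qed.

(** Everything between the slot holding [v i] and [t] is absorbed into the middle factor of
    [slot_nil]. *)
Lemma slot_word_nil v m i y t : (i < m)%N -> N (v i) -> slot t ->
  I (slot_word v m ** y ** t (v i)).
Proof.
move=> im Nv St; elim: m im y => //= m IH; rewrite ltnS leq_eqVlt.
case/predU1P => [im|im] y.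
  subst m.
  have -> : slot_word v i ** a i ** s i (v i) ** y ** t (v i)
    = slot_word v i ** a i ** (s i (v i) ** y ** t (v i)) by rewrite !amulA.
  by apply: idealMl => //; exact: slot_nil.
have -> : slot_word v m ** a m ** s m (v m) ** y ** t (v i)
    = slot_word v m ** (a m ** s m (v m) ** y) ** t (v i) by rewrite !amulA.
exact: IH.
Qed.

Lemma slot_word_swap v m j y t u w : (j < m)%N -> N u -> N w -> slot t ->
  I (slot_word (replace v j u) m ** y ** t w
     - (-1) ^+ k *: (slot_word (replace v j w) m ** y ** t u)).
Proof.
move=> jm Nu Nw St; elim: m jm y => //= m IH; rewrite ltnS leq_eqVlt.
case/predU1P => [jm|jm] y; last first.
  have rE x : replace v j x m = v m by rewrite /replace gtn_eqF.
  by have := IH jm (a m ** s m (v m) ** y); rewrite !rE !amulA.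
subst m; have rE x : replace v j x j = x by rewrite /replace eqxx.
have wE x : slot_word (replace v j x) j = slot_word v j.
  by apply: eq_slot_word => i ij; rewrite /replace ltn_eqF.
rewrite !rE !wE -!amulA -2!amulZr -2!amulBr; do 2!apply: idealMl => //.
by rewrite !amulA; exact: slot_swap.
Qed.

End Existence.

(* y_j is a word with v_m in the place of v_j, and c_j puts v_j in the last slot,
   so that c_j repeats a letter of y_i unless i = j. *)
Lemma dual_system_exists (slot : (A -> A) -> Prop) (N : A -> Prop) k x0 :
  (forall s t u y, slot s -> slot t -> N u -> I (s u ** y ** t u)) ->
  (forall s t u v y, slot s -> slot t -> N u -> N v ->
    I (s u ** y ** t v - (-1) ^+ k *: (s v ** y ** t u))) ->
  (forall w, ~ I w -> exists b t u, [/\ slot t, N u & ~ I (w ** b ** t u)]) ->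
  ~ I x0 ->
  forall m, exists y c t, dual_system m y c t /\ ~ I t.
Proof.
move=> slot_nil slot_swap slot_ext nIx0 m.
(* [f w] holds a context, a slot and a letter that extend [w] while staying outside [I]; for [w] in
   [I] the extension of [x0] serves as a default. *)
have /choice[f fP] w : exists d : A * (A -> A) * A,
    [/\ slot d.1.2, N d.2 & ~ I w -> ~ I (w ** d.1.1 ** d.1.2 d.2)].
  case: (pselect (I w)) => Iw.
    by have [b [t [u [St Nu _]]]] := slot_ext _ nIx0; exists (b, t, u); split.
  by have [b [t [u [St Nu h]]]] := slot_ext _ Iw; exists (b, t, u); split.
pose g w := w ** (f w).1.1 ** (f w).1.2 (f w).2.
pose st i := iter i g x0.
pose a i := (f (st i)).1.1; pose s i := (f (st i)).1.2; pose v i := (f (st i)).2.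
have slot_s i : slot (s i) by case: (fP (st i)).
have Nv i : N (v i) by case: (fP (st i)).
have stE i : slot_word x0 a s v i = st i by elim: i => //= i ->.
have nIst i : ~ I (st i) by elim: i => //= i IH; case: (fP (st i)) => _ _; exact.
exists (fun j => slot_word x0 a s (replace v j (v m)) m ** a m),
  (* The sign undoes that of [slot_swap]; for [j = m] nothing is exchanged. *)
  (fun j => if j == m then s m (v m) else (-1) ^+ k *: s m (v j)), (st m.+1).
split=> //; split=> [j|i j im jm ij].
  rewrite -stE /= leq_eqVlt => /predU1P[->|jm].
    rewrite eqxx (@eq_slot_word _ _ _ (replace v m (v m)) v).
      by exact: subgroup_refl.
    by move=> i im; rewrite /replace ltn_eqF.
  rewrite ltn_eqF // amulZr -[X in _ - X](signrZK k) -scalerBr.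
  apply: subgroup_sign => //.
  have := slot_word_swap slot_swap x0 a slot_s v (a m) jm (Nv m) (Nv j)
    (slot_s m).
  rewrite (@eq_slot_word _ _ _ (replace v j (v j)) v) // => l _.
  by rewrite /replace; case: eqP => // ->.
suff : I (slot_word x0 a s (replace v i (v m)) m ** a m ** s m (v j)).
  case: (eqVneq j m) => [-> //|_ h]; rewrite amulZr; exact: subgroup_sign.
(* The letter [v j] occurs in y_i at its own place [j], or at place [i] if [j = m]. *)
have [l lm <-] : exists2 l, (l < m)%N & replace v i (v m) l = v j.
  move: jm; rewrite leq_eqVlt => /predU1P[jm|jm].
    exists i; last by rewrite /replace eqxx jm.
    by rewrite ltn_neqAle im -jm ij.
  by exists j => //; rewrite /replace eq_sym (negPf ij).
apply: (slot_word_nil slot_nil) => //.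
by rewrite /replace; case: ifP.
Qed.

End DualSystems.

(** * The opposite algebra, which yields the right-handed dual systems *)

Definition opposite (K : fieldType) (A : assocAlgType K) : Type := A.

Section Opposite.
Variables (K : fieldType) (A : assocAlgType K).

HB.instance Definition _ := GRing.Lmodule.on (opposite A).

Let opmul (x y : opposite A) : opposite A := (y : A) ** (x : A).

Let opmulA : associative opmul.
Proof. by move=> x y z; rewrite /opmul amulA. Qed.

Let opmulDl : left_distributive opmul +%R.
Proof. by move=> x y z; exact: amulDr. Qed.

Let opmulDr : right_distributive opmul +%R.
Proof. by move=> x y z; exact: amulDl. Qed.

Let opmulZl (k : K) x y : opmul (k *: x) y = k *: opmul x y.
Proof. exact: amulZr. Qed.

Let opmulZr (k : K) x y : opmul x (k *: y) = k *: opmul x y.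
Proof. exact: amulZl. Qed.

HB.instance Definition _ := Lmodule_isAssocAlgebra.Build K (opposite A)
  opmulA opmulDl opmulDr opmulZl opmulZr.

Lemma opposite_amulE (x y : opposite A) : x ** y = ((y : A) ** (x : A) : A).
Proof. by []. Qed.

Lemma ideal_opposite (I : A -> Prop) :
  ideal I -> @ideal K (opposite A) I.
Proof. by case=> -[I0 IB] Ir Il; split=> // x a; [exact: Il | exact: Ir]. Qed.

End Opposite.

(** * Strictly increasing chains attached to a pair of elements *)

Section Chains.
Variables (K : fieldType) (A : assocAlgType K) (I : A -> Prop).
Hypothesis idealI : ideal I.
Let sI := ideal_subgroup idealI.
Implicit Types (b g x y z t : A).

(** A Wong sequence, modulo [I], of the pencil formed by the right multiplications by [g] and
    [b]. *)
Fixpoint pencil_chain b g m : A -> Prop :=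
  if m is m'.+1 then
    fun y => exists2 z, pencil_chain b g m' z & I (y ** g - z ** b)
  else I.

Lemma pencil_chainS b g m y : pencil_chain b g m y -> pencil_chain b g m.+1 y.
Proof.
elim: m y => [|m IH] y /=; last by case=> z /IH Wz h; exists z.
move=> Iy; exists 0; first exact: subgroup0.
by rewrite amul0x subr0; exact: idealMr.
Qed.

Lemma pencil_chain_leq b g m n y : (m <= n)%N ->
  pencil_chain b g m y -> pencil_chain b g n y.
Proof.
move=> mn Wy; rewrite -(subnK mn); elim: (n - m)%N => // k.
by rewrite addSn; exact: pencil_chainS.
Qed.

Lemma sum_mod_one n (F : 'I_n -> A) i t :
  I (F i - t) -> (forall j, j != i -> I (F j)) -> I (\sum_(j < n) F j - t).
Proof.
move=> Fi FI; rewrite (bigD1 i) //= addrAC; apply: subgroupD => //.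
by apply: big_ind => //; [exact: subgroup0 | exact: subgroupD].
Qed.

(** Modulo [I], y_(j+1) g = t d_(j+1) = y_j b and y_0 g = 0, which puts y_m in W_(m+1). Dually b
    x_(j+1) = c_j t' and g x_(j+1) = c_(j+1) t', so z g x_m = 0 for all z in W_m, whereas y_m g x_m
    = t t'. *)
Lemma pencil_chain_strict n (y c d x : nat -> A) t t' :
  dual_system I n y c t ->
  (forall i, (i <= n)%N -> I (d i ** x i - t')) ->
  (forall i j, (i <= n)%N -> (j <= n)%N -> i != j -> I (d i ** x j)) ->
  ~ I (t ** t') ->
  exists b g, forall m, (0 < m <= n)%N ->
    pencil_chain b g m.+1 (y m) /\ ~ pencil_chain b g m (y m).
Proof.
move=> [yc yc0] dx dx0 nItt.
exists (\sum_(i < n) c i ** d i.+1), (\sum_(i < n) c i.+1 ** d i.+1).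
set b := \sum_(i < n) c i ** _; set g := \sum_(i < n) _.
have ltS (i : 'I_n) : (i.+1 <= n)%N by exact: ltn_ord.
have leo (i : 'I_n) : (i <= n)%N by exact/ltnW/ltn_ord.
have yg j : (j < n)%N -> I (y j.+1 ** g - t ** d j.+1).
  move=> jn; rewrite amul_sumrx; apply: (sum_mod_one (i := Ordinal jn)) => /=.
    by rewrite amulA -amulBl; apply: idealMr => //; exact: yc.
  move=> i ij; rewrite amulA; apply: idealMr => //; apply: yc0 => //.
  by rewrite eqSS eq_sym.
have yb j : (j < n)%N -> I (y j ** b - t ** d j.+1).
  move=> jn; rewrite amul_sumrx; apply: (sum_mod_one (i := Ordinal jn)) => /=.
    by rewrite amulA -amulBl; apply: idealMr => //; exact/yc/ltnW.
  move=> i ij; rewrite amulA; apply: idealMr => //; apply: yc0 => //.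
    exact: ltnW.
  by rewrite eq_sym.
have gx j : (j < n)%N -> I (g ** x j.+1 - c j.+1 ** t').
  move=> jn; rewrite amul_suml; apply: (sum_mod_one (i := Ordinal jn)) => /=.
    by rewrite -amulA -amulBr; apply: idealMl => //; exact: dx.
  by move=> i ij; rewrite -amulA; apply: idealMl => //; exact: dx0.
have bx j : (j < n)%N -> I (b ** x j.+1 - c j ** t').
  move=> jn; rewrite amul_suml; apply: (sum_mod_one (i := Ordinal jn)) => /=.
    by rewrite -amulA -amulBr; apply: idealMl => //; exact: dx.
  by move=> i ij; rewrite -amulA; apply: idealMl => //; exact: dx0.
have y_chain m : (m <= n)%N -> pencil_chain b g m.+1 (y m).
  elim: m => [_|m IH mn].
    exists 0; first exact: subgroup0.
    rewrite amul0x subr0 amul_sumrx; apply: subgroup_sum => // i.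
    by rewrite amulA; apply: idealMr => //; exact: yc0.
  exists (y m); first exact/IH/ltnW.
  exact: subgroup_trans (yg _ mn) (subgroup_sym sI (yb _ mn)).
(* If z g = z' b modulo [I] with z' one level lower, then z g x_(m+1) = z' b x_(m+1) = z' c_m t' =
   z' g x_m. *)
have x_chain m z : (m < n)%N -> pencil_chain b g m.+1 z -> I (z ** g ** x m.+1).
  elim: m z => [|m IH] z mn [z' Wz' h].
    rewrite -(subrK (z' ** b) (z ** g)) amulDl; apply: subgroupD => //.
      exact: idealMr.
    by do 2!apply: idealMr => //.
  rewrite -(subrK (z' ** b) (z ** g)) amulDl; apply: subgroupD => //.
    exact: idealMr.
  have {}IH := IH z' (ltnW mn) Wz'; rewrite -amulA in IH.
  rewrite -amulA; apply: subgroup_congr IH => //; rewrite -amulBr.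
  apply: idealMl => //.
  exact: subgroup_trans (bx _ mn) (subgroup_sym sI (gx _ (ltnW mn))).
case=> // m /andP[_ mn]; split; first exact: y_chain.
move=> /(x_chain _ _ mn) h; apply: nItt.
have h1 : I (t ** t' - t ** d m.+1 ** x m.+1).
  rewrite -amulA -amulBr; apply: idealMl => //; apply: subgroup_sym => //.
  exact: dx.
apply: subgroup_congr h1 _ => //.
have h2 := idealMr (x m.+1) idealI (subgroup_sym sI (yg _ mn)).
by rewrite amulBl in h2; exact: subgroup_congr h2 h.
Qed.

End Chains.

(** * Automorphisms, invariant sets and bounds from finitely many orbits *)

Section Automorphisms.
Variables (K : fieldType) (A : assocAlgType K).
Implicit Types (f : A -> A) (P Q S I R : A -> Prop).

Definition invariant P := forall f, is_automorphism f -> forall x, P x -> P (f x).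

Lemma automorphism_inv f : is_automorphism f ->
  exists g, [/\ is_automorphism g, cancel f g & cancel g f].
Proof.
case=> -[g fK gK] fD fM; exists g; split=> //; split; first by exists f.
  by move=> x y; apply: (can_inj fK); rewrite fD !gK.
by move=> x y; apply: (can_inj fK); rewrite fM !gK.
Qed.

Lemma automorphism_comp f g :
  is_automorphism f -> is_automorphism g -> is_automorphism (f \o g).
Proof.
case=> bf fD fM [bg gD gM]; split; first exact: bij_comp.
  by move=> x y /=; rewrite gD fD.
by move=> x y /=; rewrite gM fM.
Qed.

Lemma automorphism0 f : is_automorphism f -> f 0 = 0.
Proof. by case=> _ fD _; apply: (addrI (f 0)); rewrite -fD !addr0. Qed.

Lemma automorphismB f x y : is_automorphism f -> f (x - y) = f x - f y.
Proof.
by move=> [_ fD _]; apply: (addIr (f y)); rewrite -fD !subrK.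
Qed.

Lemma automorphismM f x y : is_automorphism f -> f (x ** y) = f x ** f y.
Proof. by case. Qed.

Lemma automorphism_word f u a xs : is_automorphism f ->
  f (word u a xs) = word (f u) (f a) (map f xs).
Proof.
by move=> af; elim: xs a => //= x xs IH a; rewrite IH !automorphismM.
Qed.

Lemma invariant_span S : invariant S -> invariant (span S).
Proof.
move=> iS f af x; elim=> [|a b Sa _ IH].
  by rewrite automorphism0 //; exact: span_zero.
by have [_ -> _] := af; apply: span_add => //; exact: iS.
Qed.

Lemma invariant_sandwich I : invariant I -> invariant (trivial_sandwich I).
Proof.
move=> iI f af e he z; have [g [_ _ gK]] := automorphism_inv af.
by rewrite -(gK z) -!automorphismM //; exact/iI/he.
Qed.

Lemma invariant_word I k : invariant I ->
  invariant (fun u => forall a xs, size xs = k -> I (word u a xs)).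
Proof.
move=> iI f af u hu a xs sxs; have [g [_ _ gK]] := automorphism_inv af.
rewrite -(gK a) -(mapK gK xs) -automorphism_word //; apply: iI => //.
by apply: hu; rewrite size_map.
Qed.

Lemma invariant_pencil_chain I f b g m y : invariant I -> is_automorphism f ->
  pencil_chain I b g m y -> pencil_chain I (f b) (f g) m (f y).
Proof.
move=> iI af; elim: m y => [|m IH] y /=; first exact: iI.
case=> z /IH Wz h; exists (f z) => //.
by rewrite -!automorphismM // -automorphismB //; exact: iI.
Qed.

Definition orbit_representatives (s : seq A) :=
  forall x, exists2 v, v \in s & exists2 f, is_automorphism f & x = f v.

Lemma omega_categorical_orbits : omega_categorical A ->
  exists s, orbit_representatives s.
Proof.
move=> /(_ 1)[s hs]; exists (map (@thead _ _) s) => x.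
have [v vs [f af xE]] := hs [tuple x]; exists (thead v); first exact: map_f.
exists f => //; move/(congr1 (@thead _ _)): xE.
by rewrite theadE (tuple_eta v) /= => ->; rewrite !theadE.
Qed.

Lemma omega_categorical_orbits3 : omega_categorical A ->
  exists s : seq (A * A * A), forall x y z, exists2 v, v \in s &
    exists f, [/\ is_automorphism f, x = f v.1.1, y = f v.1.2 & z = f v.2].
Proof.
move=> /(_ 3)[s hs].
pose h (v : 3.-tuple A) := (tnth v 0, tnth v 1, tnth v 2).
exists (map h s) => x y z; have [v vs [f af xE]] := hs [tuple x; y; z].
exists (h v); first exact: map_f.
have E i : tnth [tuple x; y; z] i = f (tnth v i) by rewrite xE tnth_map.
by exists f; split=> //; [exact: (E 0) | exact: (E 1) | exact: (E 2)].
Qed.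

(** Finitely many orbits replace compactness: a bound for a representative holds along its orbit by
    invariance, and the maximum of these bounds works everywhere. *)
Lemma invariant_bound (s : seq A) (P : A -> Prop) (R : nat -> A -> Prop) :
  orbit_representatives s -> invariant P -> (forall k, invariant (R k)) ->
  (forall k x, R k x -> R k.+1 x) ->
  (forall x, P x -> exists k, R k x) -> exists k, forall x, P x -> R k x.
Proof.
move=> hs iP iR RS PR.
have Rle j k x : (j <= k)%N -> R j x -> R k x.
  by move=> jk Rj; rewrite -(subnK jk); elim: (k - j)%N => // i; exact: RS.
have [k hk] : exists k, forall v, v \in s -> P v -> R k v.
  elim: (s) => [|v t [k hk]]; first by exists 0.
  have [j hj] : exists j, P v -> R j v.
    by case: (pselect (P v)) => [/PR[j Rj]|nP]; [exists j | exists 0].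
  exists (maxn j k) => u; rewrite inE => /predU1P[->|ut] Pu.
    exact: Rle (leq_maxl _ _) (hj Pu).
  exact: Rle (leq_maxr _ _) (hk _ ut Pu).
exists k => x Px; have [v vs [f af xE]] := hs x.
rewrite xE; apply: iR => //; apply: hk => //.
have [g [ag fK _]] := automorphism_inv af.
by rewrite -(fK v) -xE; exact: iP.
Qed.

(** * Primeness modulo a maximal invariant ideal with non-nilpotent quotient *)

Section Prime.
Variable I : A -> Prop.
Hypotheses (idealI : ideal I) (invI : invariant I).
Hypothesis nilpotent_above : forall J, ideal J -> invariant J ->
  (forall x, I x -> J x) -> (exists2 x, J x & ~ I x) ->
  exists l, forall x, apow l x -> J x.
Hypothesis not_nilpotent : ~ exists l, forall x : A, apow l x -> I x.
Let sI := ideal_subgroup idealI.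

(** Otherwise the annihilators [Z] of A Q and [Y] of Z A, taken modulo [I], are invariant ideals
    containing [p] and [q], so strictly above [I]. Both then contain a power of [A], and so does
    [I], as Z A Y lies in [I]. *)
Lemma prime_modulo P Q p q : invariant P -> invariant Q ->
  P p -> ~ I p -> Q q -> ~ I q -> exists x a y, [/\ P x, Q y & ~ I (x ** a ** y)].
Proof.
move=> iP iQ Pp nIp Qq nIq; apply: contrapT => no.
have PQ x a y : P x -> Q y -> I (x ** a ** y).
  by move=> Px Qy; apply: contrapT => h; apply: no; exists x, a, y.
pose Z w := forall a y, Q y -> I (w ** a ** y).
have idealZ : ideal Z.
  split; [split=> [a y _|w z Zw Zz a y Qy] | move=> w b Zw a y Qy |
          move=> b w Zw a y Qy].
  - by rewrite !amul0x; exact: subgroup0.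
  - by rewrite !amulBl; apply: subgroupB => //; [exact: Zw | exact: Zz].
  - by rewrite -(amulA w); exact: Zw.
  - by rewrite -!amulA; apply: idealMl => //; rewrite amulA; exact: Zw.
have invZ : invariant Z.
  move=> f af w Zw a y Qy; have [g [ag _ gK]] := automorphism_inv af.
  rewrite -(gK a) -(gK y) -!automorphismM //; apply: invI => //.
  by apply: Zw; exact: iQ.
have [l hl] : exists l, forall x, apow l x -> Z x.
  apply: nilpotent_above => //; last by exists p => // a y; exact: PQ.
  by move=> x Ix a y _; do 2!apply: idealMr => //.
pose Y y := forall w a, Z w -> I (w ** a ** y).
have idealY : ideal Y.
  split; [split=> [w a _|x z Yx Yz w a Zw] | move=> x b Yx w a Zw |
          move=> b x Yx w a Zw].
  - by rewrite !amulx0; exact: subgroup0.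
  - by rewrite !amulBr; apply: subgroupB => //; [exact: Yx | exact: Yz].
  - by rewrite amulA; apply: idealMr => //; exact: Yx.
  - by rewrite amulA -(amulA w); exact: Yx.
have invY : invariant Y.
  move=> f af y Yy w a Zw; have [g [ag _ gK]] := automorphism_inv af.
  rewrite -(gK a) -(gK w) -!(automorphismM _ _ af); apply: invI => //.
  by apply: Yy; exact: invZ.
have [l' hl'] : exists l, forall x, apow l x -> Y x.
  apply: nilpotent_above => //; last by exists q => // w a Zw; exact: Zw.
  by move=> x Ix w a _; exact: idealMl.
(* These are products of [l + l' + 3] factors: [l + 1] give an element of [Z], one is the middle
   factor, [l' + 1] give an element of [Y]. *)
apply: not_nilpotent; exists (l + l'.+1).+1 => x /apow_split.
apply: span_sub => //.
move=> _ [a [b [la lb ->]]].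
have /apow_split : apow (0 + l').+1 b := lb.
apply: (span_sub (Z := fun b => I (a ** b))).
  split=> [|c d]; first by rewrite amulx0; exact: subgroup0.
  by rewrite amulBr; exact: subgroupB.
by move=> _ [c [d [_ ld ->]]]; rewrite amulA; apply: hl' => //; exact: hl.
Qed.

Let automorphic_images (w x : A) := exists2 f, is_automorphism f & x = f w.

Let invariant_images w : invariant (automorphic_images w).
Proof.
move=> f af _ [g ag ->]; exists (f \o g) => //; exact: automorphism_comp.
Qed.

Let automorphic_refl w : automorphic_images w w.
Proof. by exists id => //; split=> //; exists id. Qed.

(** [prime_modulo] is applied to the orbit of [w], and the inverse automorphism carries the
    resulting product back to [w] itself. *)
Lemma prime_modulor Q q w : invariant Q -> Q q -> ~ I q -> ~ I w ->
  exists a y, Q y /\ ~ I (w ** a ** y).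
Proof.
move=> iQ Qq nIq nIw.
have [_ [a [y [[f af ->] Qy nI]]]] :=
  prime_modulo (@invariant_images w) iQ (automorphic_refl w) nIw Qq nIq.
have [g [ag fK gK]] := automorphism_inv af.
exists (g a), (g y); split; first exact: iQ.
by move=> /(invI af); rewrite !automorphismM // !gK.
Qed.

Lemma prime_modulol Q q w : invariant Q -> Q q -> ~ I q -> ~ I w ->
  exists a y, Q y /\ ~ I (y ** a ** w).
Proof.
move=> iQ Qq nIq nIw.
have [y [a [_ [Qy [f af ->] nI]]]] :=
  prime_modulo iQ (@invariant_images w) Qq nIq (automorphic_refl w) nIw.
have [g [ag fK gK]] := automorphism_inv af.
exists (g a), (g y); split; first exact: iQ.
by move=> /(invI af); rewrite !automorphismM // !gK.
Qed.

End Prime.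
End Automorphisms.

Lemma count_lt (T : eqType) (a b : pred T) (s : seq T) v :
  subpred a b -> v \in s -> b v -> ~~ a v -> (count a s < count b s)%N.
Proof.
move=> ab + bv av; elim: s => //= x s IH; rewrite inE => /predU1P[<-|vs].
  by rewrite bv (negPf av) add0n add1n ltnS sub_count.
by rewrite -addnS leq_add ?IH //; case: (a x) (ab x) => // ->.
Qed.

(** * Nilpotency of the algebra and of its adjoint group *)

Section Nilpotency.
Variables (K : fieldType) (A : nilAlgType K).
Hypothesis omegaA : omega_categorical A.
Implicit Types (I J P Q : A -> Prop).

Lemma iter_amul k (x a : A) : iter k.+1 (amul x) a = apowS x k ** a.
Proof. by elim: k => //= k IH; rewrite IH amulA. Qed.

(** The nil index is constant on orbits, so finitely many orbits bound it. *)
Lemma nil_bounded : exists k, forall x : A, apowS x k = 0.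
Proof.
have [s hs] := omega_categorical_orbits omegaA.
have [||k x xk|x _|k hk] :=
  @invariant_bound _ _ s (fun=> True) (fun k (x : A) => apowS x k = 0) hs.
- by [].
- move=> k f af x xk; rewrite -(automorphism0 af) -xk /apowS.
  by elim: (k) => //= j ->; rewrite automorphismM.
- by rewrite -(amulx0 x) -xk.
- by have [k /eqP] := Defs.nilP x; exists k.
by exists k => x; exact: hk.
Qed.

Section Step.
Variable I : A -> Prop.
Hypotheses (idealI : ideal I) (invI : invariant I).
Hypothesis nilpotent_above : forall J, ideal J -> invariant J ->
  (forall x, I x -> J x) -> (exists2 x, J x & ~ I x) ->
  exists l, forall x, apow l x -> J x.
Hypothesis not_nilpotent : ~ exists l, forall x : A, apow l x -> I x.
Let sI := ideal_subgroup idealI.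

Lemma sandwich_exists : exists2 e, ~ I e & trivial_sandwich I e.
Proof.
have [a nIa] : exists a, ~ I a.
  by apply/existsNP => aI; apply: not_nilpotent; exists 0.
have [k hk] := nil_bounded; apply: (@levitzki _ _ _ idealI k a) => // z.
by rewrite iter_amul hk amul0x; exact: subgroup0.
Qed.

Let N := span (trivial_sandwich I).

Lemma sandwich_span_subgroup : subgroup N.
Proof.
apply: span_subgroup => e he z; rewrite amulxN !amulNx opprK; exact: he.
Qed.

(** Each sum of trivial sandwiches has an exponent by [sandwich_word], and [invariant_bound] makes
    it uniform on [N]. The descent to the least exponent stops above 1, since primeness gives e a y
    outside [I] with [y] in [N]. *)
Lemma sandwich_span_vanishing : exists2 n,
  (0 < n)%N & vanishing I N n.+1 /\ ~ vanishing I N n.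
Proof.
have [e nIe he] := sandwich_exists.
have Ne : N e by exact: span_mem.
have iN : invariant N by apply: invariant_span; exact: invariant_sandwich.
have n0 : ~ vanishing I N 0 by move=> /(_ e e [::] Ne erefl).
have n1 : ~ vanishing I N 1.
  have [a [y [Ny nI]]] :=
    prime_modulor idealI invI nilpotent_above not_nilpotent iN Ne nIe nIe.
  by move=> /(_ y e [:: a] Ny erefl).
have [s hs] := omega_categorical_orbits omegaA.
have [||||k hk] := @invariant_bound _ _ s N
  (fun k u => forall a xs, size xs = k -> I (word u a xs)) hs.
- exact: iN.
- by move=> k; exact: invariant_word.
- move=> k u hu a [|x xs] // [sxs]; exact: (hu (a ** x ** u)).
- move=> u; elim=> [|f v hf _ [k hk]].
    exists 1 => a [|x [|//]] //= _; rewrite amulx0; exact: subgroup0.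
  by exists (k + k)%N; rewrite addrC; exact: sandwich_word.
have {hs s} : vanishing I N k by move=> u a xs Nu; exact: hk.
elim: k {hk} => [//|k IH] vk.
case: (pselect (vanishing I N k)) => [//|nvk].
by exists k => //; rewrite lt0n; apply/eqP => k0; apply: n1; rewrite -k0 in vk *.
Qed.

(** Slots are words with [n] letters. As vanishing fails at [n], some such word is outside [I], and
    primeness extends any element outside [I] by words of this kind, on either side. *)
Lemma pencil_chain_exists m : exists b g (y : nat -> A),
  forall i, (0 < i <= m)%N ->
    pencil_chain I b g i.+1 (y i) /\ ~ pencil_chain I b g i (y i).
Proof.
have [e nIe _] := sandwich_exists.
have [n n_gt0 [vN nvN]] := sandwich_span_vanishing.
have sN := sandwich_span_subgroup.
have iN : invariant N by apply: invariant_span; exact: invariant_sandwich.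
pose slot (s : A -> A) :=
  exists b xs, size xs = n /\ s = (fun u => word u b xs).
pose Q x := exists u b xs, [/\ N u, size xs = n & x = word u b xs].
have iQ : invariant Q.
  move=> f af _ [u [b [xs [Nu sxs ->]]]]; exists (f u), (f b), (map f xs).
  by rewrite size_map automorphism_word //; split=> //; exact: iN.
have [q Qq nIq] : exists2 q, Q q & ~ I q.
  apply: contrapT => no; apply: nvN => u a xs Nu sxs.
  by apply: contrapT => nI; apply: no; exists (word u a xs) => //; exists u, a, xs.
have slot_nil s t u y : slot s -> slot t -> N u -> I (s u ** y ** t u).
  move=> [b [xs [sxs ->]]] [c [ys [sys ->]]] Nu.
  exact: (word_nil idealI n_gt0 vN).
have slot_swap s t u v y : slot s -> slot t -> N u -> N v ->
    I (s u ** y ** t v - (-1) ^+ n *: (s v ** y ** t u)).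
  move=> [b [xs [sxs ->]]] [c [ys [sys ->]]] Nu Nv.
  exact: (word_swap idealI sN n_gt0 vN).
have Q_slot x : Q x -> exists t u, [/\ slot t, N u & x = t u].
  move=> [u [b [xs [Nu sxs ->]]]]; exists (fun u => word u b xs), u.
  by split=> //; exists b, xs.
have left_dual : exists (y c : nat -> A) t, dual_system I m y c t /\ ~ I t.
  apply: dual_system_exists nIe _ => // [s t u y||w nIw].
  - exact: slot_nil.
  - exact: slot_swap.
  - have [b [x [/Q_slot[t [u [St Nu ->]]] nI]]] :=
    prime_modulor idealI invI nilpotent_above not_nilpotent iQ Qq nIq nIw.
  by exists b, t, u.
have right_dual : exists (y c : nat -> A) t,
    @dual_system _ (opposite A) I m y c t /\ ~ I t.
  apply: (@dual_system_exists _ (opposite A) I (ideal_opposite idealI)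
    slot N n e) => // [s t u y Ss St Nu|s t u v y Ss St Nu Nv|w nIw].
  - by rewrite !opposite_amulE amulA; exact: slot_nil.
  - rewrite !opposite_amulE !amulA; exact: slot_swap.
  - have [b [x [/Q_slot[t [u [St Nu ->]]] nI]]] :=
      prime_modulol idealI invI nilpotent_above not_nilpotent iQ Qq nIq nIw.
    by exists b, t, u; split=> //; rewrite !opposite_amulE amulA.
(* The product t t' may lie in [I]. Primeness repairs this only up to a choice in an invariant set,
   so having a right dual system is stated as an invariant property of its value. *)
pose right_value t := exists d x : nat -> A,
  (forall i, (i <= m)%N -> I (d i ** x i - t)) /\
  (forall i j, (i <= m)%N -> (j <= m)%N -> i != j -> I (d i ** x j)).
have inv_right : invariant right_value.
  move=> f af t [d [x [h h0]]]; exists (f \o d), (f \o x).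
  split=> [i im|i j im jm ij].
    by rewrite /= -automorphismM // -automorphismB //; exact/invI/h.
  by rewrite /= -automorphismM //; exact/invI/h0.
have [x [d [t' [[xd xd0] nIt']]]] := right_dual.
have rt' : right_value t'.
  exists d, x; split=> // i j im jm ij; apply: xd0 => //; by rewrite eq_sym.
have [y [c [t [[yc yc0] nIt]]]] := left_dual.
have [a [t1 [[d1 [x1 [h h0]]] nI]]] :=
  prime_modulor idealI invI nilpotent_above not_nilpotent inv_right rt' nIt' nIt.
(* The connecting factor [a] is absorbed into the c_i. *)
have dual1 : dual_system I m y (fun i => c i ** a) (t ** a).
  split=> [i im|i j im jm ij]; rewrite amulA; last first.
    by apply: idealMr => //; exact: yc0.
  by rewrite -amulBl; apply: idealMr => //; exact: yc.
have [b [g hbg]] := pencil_chain_strict idealI dual1 h h0 nI.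
by exists b, g, y.
Qed.

Lemma nilpotent_step : False.
Proof.
have [s hs] := omega_categorical_orbits3 omegaA.
(* One more level than representatives, for the pigeonhole principle; the levels are numbered from
   1. *)
have [b [g [y hy]]] := pencil_chain_exists (size s).+1.
have /choice[r hr] i : exists v, v \in s /\
    exists f, [/\ is_automorphism f, b = f v.1.1, g = f v.1.2 & y i = f v.2].
  by have [v vs hv] := hs b g (y i); exists v.
suff r_uniq : uniq [seq r i.+1 | i <- iota 0 (size s).+1].
  suff : (size [seq r i.+1 | i <- iota 0 (size s).+1] <= size s)%N.
    by rewrite size_map size_iota ltnn.
  by apply: uniq_leq_size => // _ /mapP[i _ ->]; case: (hr i.+1).
(* Automorphisms preserve the chain, so the level of y_i can be read off the representative of its
   triple. *)
have chain_r i k : pencil_chain I (r i).1.1 (r i).1.2 k (r i).2 <->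
    pencil_chain I b g k (y i).
  have [_ [f [af -> -> ->]]] := hr i; split; first exact: invariant_pencil_chain.
  have [f' [af' fK _]] := automorphism_inv af.
  by move/(invariant_pencil_chain invI af'); rewrite !fK.
rewrite map_inj_in_uniq ?iota_uniq // => i j; rewrite !mem_iota /= !add0n.
suff lt_neq i' j' : (i' < j' <= size s)%N -> r i'.+1 <> r j'.+1.
  move=> im jm rE; case: (ltngtP i j) => // ij.
    by case: (@lt_neq i j); rewrite ?ij.
  by case: (@lt_neq j i); rewrite ?ij.
move=> /andP[ij js] rE.
have [|Wi _] := hy i'.+1; first by rewrite /= ltnS (leq_trans (ltnW ij)).
have [|_ nWj] := hy j'.+1; first by rewrite /= ltnS.
apply/nWj/chain_r; rewrite -rE; apply/chain_r.
by apply: pencil_chain_leq Wi.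
Qed.

End Step.

(** Induction on the number of representatives outside [I]: an invariant ideal strictly above [I]
    contains at least one more, so the induction hypothesis supplies the maximality required by
    [nilpotent_step]. *)
Lemma nilpotent_modulo I : ideal I -> invariant I ->
  exists l, forall x : A, apow l x -> I x.
Proof.
have [s hs] := omega_categorical_orbits omegaA.
have [k] := ubnP (count (fun x => ~~ `[< I x >]) s).
elim: k I => // k IH I ck idealI invI; apply: contrapT => nil.
apply: (nilpotent_step idealI invI _ nil) => J idealJ invJ IJ [x Jx nIx].
apply: IH => //; rewrite (leq_trans _ (ltnSE ck)) //.
have [v vs [f af xE]] := hs x.
have nIv : ~ I v by move/(invI f af); rewrite -xE.
have Jv : J v.
  have [g [ag fK _]] := automorphism_inv af.
  by rewrite -(fK v) -xE; exact: invJ.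
apply: count_lt vs _ _ => [u||].
- by move=> /asboolPn nJ; apply/asboolPn => /IJ.
- by apply/asboolPn.
- by rewrite negbK; apply/asboolP.
Qed.

Theorem nilpotent_algebra : exists l, forall x : A, apow l x -> x = 0.
Proof.
apply: (@nilpotent_modulo (fun x => x = 0)); last first.
  by move=> f af x ->; rewrite automorphism0.
split; [split=> // x y -> ->; exact: subr0 | move=> x a -> | move=> a x ->].
  exact: amul0x.
exact: amulx0.
Qed.

(** Group commutators reduce to ring commutators: if [w] is the adjoint inverse of the group product
    of [z] and [y], and r = y z - z y in [A], then the commutator of [y] and [z] is r + w r. *)
Lemma lower_central_apow k (x : adjoint A) : lower_central k x -> @apow K A k x.
Proof.
elim: k x => // k IH x; have ik := apow_ideal A k.+1.
have sk := ideal_subgroup ik.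
elim=> [_ [y [z [/IH ky ->]]]||y z _ ky _ kz|y _ ky].
- have -> : [~ y, z]%g = ((z * y)^-1 * (y * z))%g.
    by rewrite commgEl conjgE invgM !mulgA.
  set w := (_^-1)%g; have w0 : w + (z * y)%g + w ** (z * y)%g = 0 :> A.
    exact: (mulVg (z * y)%g).
  have -> : (w * (y * z))%g = (y ** z - z ** y) + w ** (y ** z - z ** y) :> A.
    rewrite adjoint_mulE.
    have -> : (y * z)%g = (z * y)%g + (y ** z - z ** y) :> A.
      by rewrite !adjoint_mulE (addrC (y : A)) -[RHS]addrA (addrC (z ** y)) subrK.
    by rewrite amulDr (addrA w) addrACA w0 add0r.
  have kyz : apow k.+1 ((y : A) ** z - (z : A) ** y).
    by apply: subgroupB => //; [exact: apowMr | exact: apowMl].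
  by apply: subgroupD => //; exact: idealMl.
- exact: subgroup0.
- by apply: subgroupD (idealMr _ ik ky) => //; exact: subgroupD.
(* Solving for the adjoint inverse v of [y] gives v = - (y + y v), which lies in every ideal
   containing [y]. *)
- have : y + (y^-1)%g + (y : A) ** (y^-1)%g = 0 :> A by exact: (mulgV y).
  rewrite addrAC addrC => /eqP; rewrite addr_eq0 => /eqP ->.
  by apply: subgroupN => //; apply: subgroupD => //; exact: idealMr.
Qed.

End Nilpotency.

Theorem corollary2p10 (p n : nat) (A : nilAlgType 'F_p) :
  prime p -> (1 <= n)%N ->
  omega_categorical A ->
  engel (adjoint A) n ->
  nilpotent_group (adjoint A).
Proof.
move=> _ _ /nilpotent_algebra[l Al0] _.
by exists l => x /lower_central_apow /Al0.
Qed.
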